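(* Let $\mathcal D$ and $\mathcal D'$ be datasets of size $n\ge2$ that differ at one point, and let $\mathbf w$ and $\mathbf w'$ be the corresponding normalized IPW vectors under a randomized trial with treatment probabilities $p_0,p_1$. Then $$\|\mathbf w-\mathbf w'\|_2\le\frac{\sqrt2\,|p_1-p_0|}{p_0\wedge p_1}\,\frac{n}{n-1}.$$ In particular, if the treatment assignment is unchanged in the differing record, then $\mathbf w=\mathbf w'$.
   Context: $a\wedge b=\min\{a,b\}$. A dataset is $\mathcal D=(\mathbf x_i,a_i)_{i=1}^n$ with covariate vectors $\mathbf x_i$ and treatment assignments $a_i\in\{0,1\}$. In a randomized trial the propensity score does not depend on covariates: $\mathbb P(A=a\mid X=\mathbf x)=p_a=\mathbb P(A=a)$, with $p_0,p_1\in(0,1)$ fixed, $p_0+p_1=1$. The normalized IPW vector of $\mathcal D$ is $\mathbf w=(w_1,\dots,w_n)$ with $$w_i=\frac{n}{\sum_{j=1}^np_{a_j}^{-1}}\cdot\frac1{p_{a_i}},$$ so that $\sum_iw_i=n$; $\mathbf w'$ is defined in the same way (same $p_0,p_1$) from $\mathcal D'$, which agrees with $\mathcal D$ except that the last record $(\mathbf x_n,a_n)$ is replaced by $(\mathbf x_n',a_n')$. *)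

(* Defs.v *)
From HB Require Import structures.
From mathcomp Require Import all_boot all_order all_algebra.
From mathcomp Require Import reals.

Set Implicit Arguments.
Unset Strict Implicit.
Unset Printing Implicit Defensive.

Import Order.TTheory GRing.Theory Num.Theory.

Local Open Scope ring_scope.

(* The i-th record is (x_i, a_i); true and false encode a_i = 1 and a_i = 0. *)
Definition dataset (R : realType) (d n : nat) : Type :=
  n.-tuple ('rV[R]_d * bool)%type.

Definition treatment (R : realType) (d n : nat) (D : dataset R d n)
  (i : 'I_n) : bool := (tnth D i).2.

(* D' is D with the record at position k replaced. *)
Definition differ_at (R : realType) (d n : nat) (k : 'I_n)
  (D D' : dataset R d n) : Prop :=
  forall i : 'I_n, i != k -> tnth D i = tnth D' i.

(* The propensity score P(A = a | X = x) of a randomized trial: it is P(A = a),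
   whatever the covariates x. *)
Definition treatment_prob (R : realType) (p0 p1 : R) (a : bool) : R :=
  if a then p1 else p0.

Definition normalized_ipw (R : realType) (d n : nat) (p0 p1 : R)
  (D : dataset R d n) : 'rV[R]_n :=
  \row_(i < n)
    (n%:R / (\sum_(j < n) (treatment_prob p0 p1 (treatment D j))^-1)
     * (1 / treatment_prob p0 p1 (treatment D i))).

(* Not `|v|, which on matrices is the sup norm. *)
Definition l2norm (R : realType) (n : nat) (v : 'rV[R]_n) : R :=
  Num.sqrt (\sum_(i < n) `|v 0 i| ^+ 2).

(* Main.v *)
(* Let u_i = 1 / p_(a_i), let T be the sum of the u_i with i <> k, and let S, S'
   be the totals for D and D'. The difference of the two vectors is
   c = n (u_k - u'_k) / (S S') times the vector with entry T at k and - u_i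
   elsewhere. Since the u_i are nonnegative, the sum of their squares over
   i <> k is at most T^2, so the norm is at most
   sqrt 2 |c| T <= sqrt 2 n |u_k - u'_k| / T. Finally T >= (n - 1) / max(p0, p1)
   and p0 p1 = min(p0, p1) max(p0, p1). *)
Require Import Defs.
From HB Require Import structures.
From mathcomp Require Import all_boot all_order all_algebra.
From mathcomp Require Import reals.
From mathcomp Require Import ring.

Set Implicit Arguments.
Unset Strict Implicit.
Unset Printing Implicit Defensive.

Import Order.TTheory GRing.Theory Num.Theory.

Local Open Scope ring_scope.

(** Each term is at most the whole sum, so its square is at most the term times that sum. *)
Lemma sum_sqr_le_sqr_sum (R : realDomainType) (I : finType) (P : pred I)
    (u : I -> R) :
  (forall i, 0 <= u i) -> \sum_(i | P i) u i ^+ 2 <= (\sum_(i | P i) u i) ^+ 2.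
Proof.
move=> u0; rewrite [leRHS]expr2 mulr_suml; apply: ler_sum => i Pi.
rewrite expr2; apply: ler_wpM2l => //.
by rewrite (bigD1 i Pi) /= lerDl sumr_ge0.
Qed.

(** Isolates the effect of rescaling to a fixed total, for arbitrary nonnegative weights; the
    probabilities enter only afterwards. *)
Lemma l2norm_normalize_replace (R : realType) (n : nat) (a : R)
    (u u' : 'I_n -> R) (k : 'I_n) :
  0 <= a -> (forall i, 0 <= u i) -> 0 <= u' k ->
  (forall i, i != k -> u i = u' i) -> 0 < \sum_(i | i != k) u i ->
  l2norm (\row_i (a / (\sum_j u j) * u i) - \row_i (a / (\sum_j u' j) * u' i))
    <= Num.sqrt 2 * (a * `|u k - u' k| / \sum_(i | i != k) u i).
Proof.
move=> a0 u0 u'k0 uu' T0.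
rewrite (bigD1 k) //= [\sum_j u' j](bigD1 k) //= -(eq_bigr _ uu').
set T := \sum_(i | i != k) u i in T0 *.
have S0 : 0 < u k + T by rewrite ltr_wpDl.
have S'0 : 0 < u' k + T by rewrite ltr_wpDl.
pose c := a * (u k - u' k) / ((u k + T) * (u' k + T)).
have vk : a / (u k + T) * u k - a / (u' k + T) * u' k = c * T.
  by rewrite /c; field; rewrite !gt_eqF.
have vi i : i != k ->
    a / (u k + T) * u i - a / (u' k + T) * u' i = - c * u i.
  by move=> /uu' <-; rewrite /c; field; rewrite !gt_eqF.
(* With the denominators cleared this is [T ^+ 2 <= (u k + T) * (u' k + T)]: both totals are at
   least [T]. *)
have normc : `|c| * T <= a * `|u k - u' k| / T.
  rewrite ler_pdivlMr // -mulrA /c normrM normfV normrM (ger0_norm a0).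
  rewrite (gtr0_norm (mulr_gt0 S0 S'0)) -[leRHS]mulr1 -[leLHS]mulrA.
  apply: ler_wpM2l; first by rewrite mulr_ge0.
  rewrite mulrC ler_pdivrMr ?mulr_gt0 // mul1r.
  by apply: ler_pM; rewrite ?lerDr // ltW.
clearbody c.
(* Of the two copies of [(c * T) ^+ 2], one is the square of entry [k] and the other bounds the
   squares of all remaining entries. *)
apply: (@le_trans _ _ (Num.sqrt (2 * (`|c| * T) ^+ 2))); last first.
  rewrite sqrtrM // sqrtr_sqr ger0_norm; last by rewrite mulr_ge0 // ltW.
  by rewrite ler_wpM2l // sqrtr_ge0.
rewrite /l2norm ler_wsqrtr // (bigD1 k) //= !mxE vk real_normK ?num_real //.
rewrite (eq_bigr (fun i => c ^+ 2 * u i ^+ 2)); last first.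
  by move=> i ik; rewrite !mxE vi // real_normK ?num_real // exprMn sqrrN.
rewrite -mulr_sumr !exprMn real_normK ?num_real // [leRHS]mulr_natl mulr2n.
by rewrite lerD2l ler_wpM2l ?sqr_ge0 // sum_sqr_le_sqr_sum.
Qed.

Theorem proposition4p4 (R : realType) (d n : nat) (p0 p1 : R)
    (D D' : dataset R d n) (k : 'I_n)
    (hn : (2 <= n)%N)
    (hp0 : 0 < p0 < 1) (hp1 : 0 < p1 < 1) (hp : p0 + p1 = 1)
    (hDD' : differ_at k D D') :
  l2norm (normalized_ipw p0 p1 D - normalized_ipw p0 p1 D')
    <= Num.sqrt 2 * `|p1 - p0| / Num.min p0 p1 * (n%:R / (n%:R - 1))
  /\ (treatment D k = treatment D' k ->
      normalized_ipw p0 p1 D = normalized_ipw p0 p1 D').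
Proof.
have [p0_gt0 _] := andP hp0; have [p1_gt0 _] := andP hp1.
pose u (E : dataset R d n) i := (treatment_prob p0 p1 (treatment E i))^-1.
have wE E : normalized_ipw p0 p1 E = \row_i (n%:R / (\sum_j u E j) * u E i).
  by apply/rowP => i; rewrite !mxE div1r.
have u_gt0 E i : 0 < u E i.
  by rewrite invr_gt0 /treatment_prob; case: ifP.
have uu' i : i != k -> u D i = u D' i.
  by move=> ik; rewrite /u /treatment hDD'.
have n1_gt0 : 0 < n%:R - 1 :> R by rewrite subr_gt0 ltr1n.
have max_gt0 : 0 < Num.max p0 p1 by rewrite lt_max p0_gt0.
have min_gt0 : 0 < Num.min p0 p1 by rewrite lt_min p0_gt0.
split; last first.
  (* The weights see a record only through its treatment. *)
  move=> akk'; have uE : u D =1 u D'.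
    by move=> i; have [->|/uu'//] := eqVneq i k; rewrite /u akk'.
  rewrite !wE; apply/rowP => i; rewrite !mxE uE.
  by rewrite (eq_bigr _ (fun j _ => uE j)).
have T_ge : (n%:R - 1) / Num.max p0 p1 <= \sum_(i | i != k) u D i.
  have -> : n%:R - 1 = #|[pred i : 'I_n | i != k]|%:R :> R.
    have := cardC1 k; rewrite card_ord => ->.
    by rewrite -subn1 natrB // ltnW.
  rewrite mulr_natl -sumr_const; apply: ler_sum => i _.
  rewrite lef_pV2 ?posrE // /treatment_prob; last by case: ifP.
  by case: ifP => _; rewrite le_max lexx ?orbT.
have T_gt0 : 0 < \sum_(i | i != k) u D i.
  by apply: lt_le_trans T_ge; rewrite divr_gt0.
have u_dist : `|u D k - u D' k| <= `|p1 - p0| / (Num.min p0 p1 * Num.max p0 p1).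
  have -> : Num.min p0 p1 * Num.max p0 p1 = p0 * p1.
    by case: leP => _ //; rewrite mulrC.
  have inv_dist : p0^-1 - p1^-1 = (p1 - p0) / (p0 * p1).
    by field; rewrite !gt_eqF.
  have norm_inv_dist : `|p0^-1 - p1^-1| = `|p1 - p0| / (p0 * p1).
    by rewrite inv_dist normrM normfV (gtr0_norm (mulr_gt0 p0_gt0 p1_gt0)).
  rewrite -norm_inv_dist /u /treatment_prob.
  (* Equal treatments give distance 0; opposite ones attain the bound. *)
  by do 2![case: ifP => _]; rewrite ?subrr ?normr0 // distrC.
rewrite !wE.
apply: le_trans (l2norm_normalize_replace _ _ _ uu' T_gt0) _ => //.
- by move=> i; apply: ltW.
- exact: ltW.
rewrite -!mulrA ler_wpM2l ?sqrtr_ge0 //.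
(* [u_dist] bounds the numerator and [T_ge] the denominator; the two factors [Num.max p0 p1] then
   cancel exactly. *)
apply: (@le_trans _ _ (n%:R * (`|p1 - p0| / (Num.min p0 p1 * Num.max p0 p1))
    / ((n%:R - 1) / Num.max p0 p1))).
  rewrite mulrA; apply: ler_pM; rewrite ?mulr_ge0 ?invr_ge0 ?(ltW T_gt0) //.
    by rewrite ler_wpM2l.
  by rewrite lef_pV2 ?posrE // divr_gt0.
rewrite le_eqVlt; apply/orP; left; apply/eqP; field.
by rewrite !gt_eqF.
Qed.
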